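(* Let $G$ be a connected graph that is not a star (i.e. not isomorphic to $K_{1,k}$ for any $k\ge 0$). If $A\subseteq E(G)$ satisfies $|A|\ge |E(G)|-1$, then $\iota(G_A)\ge \iota(G)+1$.
   Context: For a graph $G$ and $D\subseteq V(G)$, $N[D]$ is the set of vertices in $D$ together with all their neighbours. $D$ is an isolating set of $G$ if the graph $G-N[D]$ has no edges; the isolation number $\iota(G)$ is the minimum size of an isolating set of $G$. For $A\subseteq E(G)$, $G_A$ denotes the graph obtained from $G$ by subdividing every edge of $A$ exactly once (an edge $uv$ is replaced by a path $u w v$ through a new vertex $w$). *)

(* Defs.v *)
From mathcomp Require Import all_boot.

Set Implicit Arguments.
Unset Strict Implicit.
Unset Printing Implicit Defensive.

Record sgraph := SGraph {
  vertex :> finType;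
  adj : rel vertex;
  adj_sym : symmetric adj;
  adj_irr : irreflexive adj
}.

Definition edges (G : sgraph) : {set {set G}} :=
  [set [set x; y] | x in [set: G], y in [set: G] & adj x y].

(* The graph with no vertex does not count as connected. *)
Definition connected (G : sgraph) : Prop :=
  0 < #|G| /\ forall x y : G, connect (@adj G) x y.

Definition isomorphic (G H : sgraph) : Prop :=
  exists2 f : G -> H, bijective f & forall x y, adj (f x) (f y) = adj x y.

Definition star_adj k : rel (option 'I_k) := fun x y => isSome x != isSome y.

Lemma star_adj_sym k : symmetric (@star_adj k).
Proof. by move=> x y; rewrite /star_adj eq_sym. Qed.

Lemma star_adj_irr k : irreflexive (@star_adj k).
Proof. by move=> x; rewrite /star_adj eqxx. Qed.

(* K_{1,k}, with centre [None]. *)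
Definition star k : sgraph := SGraph (@star_adj_sym k) (@star_adj_irr k).

Definition is_star (G : sgraph) : Prop := exists k, isomorphic G (star k).

Section Induced.
Variables (G : sgraph) (S : {set G}).

Definition induced_adj : rel {x : G | x \in S} :=
  fun x y => adj (val x) (val y).

Lemma induced_adj_sym : symmetric induced_adj.
Proof. by move=> x y; apply: adj_sym. Qed.

Lemma induced_adj_irr : irreflexive induced_adj.
Proof. by move=> x; apply: adj_irr. Qed.

Definition induced : sgraph := SGraph induced_adj_sym induced_adj_irr.

End Induced.

Definition closed_nbh (G : sgraph) (D : {set G}) : {set G} :=
  D :|: [set y | [exists x in D, adj x y]].

Definition isolating (G : sgraph) (D : {set G}) : bool :=
  edges (induced (~: closed_nbh D)) == set0.

Lemma isolatingT (G : sgraph) : isolating [set: G].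
Proof.
rewrite /isolating -subset0; apply/subsetP => e /imset2P[x y _ _ _].
by case: x => z zS; exfalso; move: zS; rewrite /closed_nbh setTU setCT inE.
Qed.

Definition isolation_number (G : sgraph) : nat :=
  #|[arg min_(D < [set: G] | isolating D) #|D|]|.

Lemma isolation_numberP (G : sgraph) :
  (exists2 D : {set G}, isolating D & #|D| = isolation_number G) /\
  (forall D : {set G}, isolating D -> isolation_number G <= #|D|).
Proof.
rewrite /isolation_number; case: arg_minnP => [|D isoD minD]; first exact: isolatingT.
by split; [exists D | exact: minD].
Qed.

Section Subdivide.
Variables (G : sgraph) (A : {set {set G}}).

(* [inl u] is an original vertex, [inr e] the vertex inserted in the edge e.
   This is G_A when [A \subset edges G]. *)
Definition subdivide_adj : rel (G + {e : {set G} | e \in A}) := fun x y =>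
  match x, y with
  | inl u, inl v => adj u v && ([set u; v] \notin A)
  | inl u, inr e => u \in val e
  | inr e, inl u => u \in val e
  | inr _, inr _ => false
  end.

Lemma subdivide_adj_sym : symmetric subdivide_adj.
Proof. by case=> [u|e] [v|f] //=; rewrite adj_sym setUC. Qed.

Lemma subdivide_adj_irr : irreflexive subdivide_adj.
Proof. by case=> [u|e] //=; rewrite adj_irr. Qed.

Definition subdivide : sgraph := SGraph subdivide_adj_sym subdivide_adj_irr.

End Subdivide.

(* Main.v *)
Require Import Defs.
From mathcomp Require Import all_boot.

Set Implicit Arguments.
Unset Strict Implicit.
Unset Printing Implicit Defensive.

(** Split a minimum isolating set of G_A into its original vertices S and its
    subdivision vertices, viewed as a set F of edges of G.  Up to the at most
    one unsubdivided edge, isolation says that every edge of G meets S or joins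
    two vertices covered by F.  If F is empty, then S is a vertex cover of a
    connected non-star graph, and one vertex can be saved: of two adjacent
    vertices of S one is superfluous, and two vertices of S at distance two can
    be replaced by a common neighbour.  Otherwise one edge of F is dropped and
    the others are replaced by endpoints; at most the dropped edge remains
    undominated, and since some other edge of G leaves it, the endpoints can be
    chosen so as to dominate it.  An unsubdivided edge ab matters when a lies in
    S and b has a neighbour covered by F: then a is exchanged for b. *)

(** * Isolating sets and edges leaving a vertex set *)

Section Isolation.
Variable G : sgraph.
Implicit Types (S D R : {set G}) (F : {set {set G}}).

Lemma edgesP (e : {set G}) :
  reflect (exists x y, adj x y /\ e = [set x; y]) (e \in edges G).
Proof.
apply: (iffP imset2P) => [[x y _]|[x [y [xy ->]]]].
  by rewrite inE => /andP[_ xy] ->; exists x, y.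
by exists x y; rewrite ?inE.
Qed.

Lemma edges_adj (x y : G) : adj x y -> [set x; y] \in edges G.
Proof. by move=> xy; apply/edgesP; exists x, y. Qed.

Lemma closed_nbhP D (y : G) :
  reflect (exists2 x, x \in D & (y = x) \/ adj x y) (y \in closed_nbh D).
Proof.
rewrite !inE; apply: (iffP orP) => [[yD|/exists_inP[x xD xy]]|[x xD [->|xy]]].
- by exists y => //; left.
- by exists x => //; right.
- by left.
- by right; apply/exists_inP; exists x.
Qed.

Lemma isolatingP D :
  reflect (forall x y, adj x y -> x \in closed_nbh D \/ y \in closed_nbh D)
    (isolating D).
Proof.
apply: (iffP eqP) => [D0 x y xy|isoD].
  apply/orP/negPn/negP; rewrite negb_or => /andP[xD yD].
  have xS : x \in ~: closed_nbh D by rewrite in_setC.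
  have yS : y \in ~: closed_nbh D by rewrite in_setC.
  set x' : induced (~: closed_nbh D) := exist _ x xS.
  set y' : induced (~: closed_nbh D) := exist _ y yS.
  have: [set x'; y'] \in edges (induced (~: closed_nbh D)).
    by apply: imset2_f; rewrite !inE.
  by rewrite D0 inE.
apply/setP => e; rewrite [RHS]inE; apply/negP => /imset2P[[x xS] [y yS] _].
rewrite !inE /= => xy _; move: (xS) (yS).
by rewrite !in_setC; case: (isoD _ _ xy) => ->.
Qed.

Lemma isolation_number_le D n :
  (forall x y, adj x y -> x \in closed_nbh D \/ y \in closed_nbh D) ->
  #|D| <= n -> isolation_number G <= n.
Proof.
move=> /isolatingP isoD; apply: leq_trans.
by have [_] := isolation_numberP G; apply.
Qed.

(** Otherwise [S] would be closed under [adj], hence under [connect], and would contain [y]. *)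
Lemma exit_edge S (x y : G) : connected G -> x \in S -> y \notin S ->
  exists u v, [/\ u \in S, v \notin S & adj u v].
Proof.
move=> [_ conn] xS yS.
case: (boolP [exists u in S, [exists v, (v \notin S) && adj u v]]).
  by case/exists_inP=> u uS /existsP[v /andP[vS uv]]; exists u, v.
move=> noexit; case/negP: yS; rewrite -(closed_connect _ (conn x y)) //.
apply: intro_closed => [|u v uv uS]; first exact/sym_connect_sym/adj_sym.
apply: contraNT noexit => vS; apply/exists_inP; exists u => //.
by apply/existsP; exists v; rewrite vS.
Qed.

(** * Recognising stars *)

Lemma universal_is_star (c : G) :
  (forall x y, adj x y = ((x == c) != (y == c))) -> is_star G.
Proof.
move=> adjc; exists #|{: {x : G | x != c}}|.
(* The isomorphism sends [c] to the centre [None] and numbers the other vertices by their rank. *)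
pose f (x : G) := omap enum_rank (insub x : option {x : G | x != c}).
have isf x : isSome (f x) = (x != c).
  by rewrite /f; case: insubP => [u -> _|/negbTE ->].
exists f; last first.
  move=> x y; rewrite adjc /= /star_adj !isf.
  by case: (x == c); case: (y == c).
pose g : star #|{: {x : G | x != c}}| -> G := oapp (fun i => val (enum_val i)) c.
exists g; rewrite /g.
  move=> x; rewrite /f; case: insubP => [u _ <-|/negPn/eqP ->] //=.
  by rewrite enum_rankK.
case=> [i|] /=; rewrite /f.
  by rewrite valK /= enum_valK.
by rewrite insubF // eqxx.
Qed.

(** For [x != c], an edge leaving [[set x]] exists by connectedness and must end in [c]. *)
Lemma star_of_cover1 (c : G) : connected G ->
  (forall x y, adj x y -> x = c \/ y = c) -> is_star G.
Proof.
move=> connG covc.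
have adjc x : x != c -> adj c x.
  move=> xc; have [|u [v [/set1P -> vx xv]]] :=
    @exit_edge [set x] x c connG (set11 x).
    by rewrite inE eq_sym.
  by case: (covc _ _ xv) => [/eqP|<-]; rewrite ?(negbTE xc) // adj_sym.
apply: (@universal_is_star c) => x y.
case: (eqVneq x c) => [->|xc]; case: (eqVneq y c) => [->|yc] /=.
- by rewrite adj_irr.
- by rewrite adjc.
- by rewrite adj_sym adjc.
by apply/negP => /covc[] /eqP; apply/negP.
Qed.

(** * Saving one vertex of a vertex cover *)

Lemma isolation_lt_cover S : connected G -> ~ is_star G ->
  (forall x y, adj x y -> x \in S \/ y \in S) -> isolation_number G < #|S|.
Proof.
move=> connG nstar covS.
have adj_case s t : s \in S -> t \in S -> adj s t -> isolation_number G < #|S|.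
  move=> sS tS st; rewrite (cardsD1 s) sS ltnS.
  have ts : t != s by apply: contraTneq st => ->; rewrite adj_irr.
  have dom x : x \in S -> x \in closed_nbh (S :\ s).
    move=> xS; apply/closed_nbhP; case: (eqVneq x s) => [->|xs].
      by exists t; rewrite ?inE ?ts //; right; rewrite adj_sym.
    by exists x; rewrite ?inE ?xs //; left.
  apply: (@isolation_number_le (S :\ s)) => // x y /covS.
  by case=> /dom; [left|right].
(* A cover with at most one vertex lies in some [[set c]], which would make [G] a star. *)
have [/card_le1_eqP S1|] := leqP #|S| 1.
  have [c Sc] : exists c, {subset S <= [set c]}.
    case: (set_0Vmem S) => [->|[c cS]].
      by have [/card_gt0P[c _] _] := connG; exists c => x; rewrite !inE.
    by exists c => x xS; apply/set1P; exact: S1.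
  case: nstar; apply: (@star_of_cover1 c) => // x y /covS.
  by case=> /Sc/set1P; [left|right].
case/card_gt1P=> s [t [sS tS st]].
case: (boolP (t \in closed_nbh [set s])) => [/closed_nbhP[_ /set1P ->]|tN].
  by case=> [/eqP|]; [rewrite eq_sym (negbTE st)|apply: adj_case].
have sN : s \in closed_nbh [set s] by apply/closed_nbhP; exists s; [exact: set11|left].
(* An edge [uv] leaving the closed neighbourhood of [s] has [u] adjacent to [s] and [v] at distance
   two. The cover contains [u], giving two adjacent members, or [v], and then [u] replaces both [s]
   and [v]. *)
have [u [v [/closed_nbhP[_ /set1P -> usu] vN uv]]] := exit_edge connG sN tN.
have su : adj s u.
  case: usu => // us; case/negP: vN; apply/closed_nbhP; exists s; rewrite ?set11 //.
  by right; rewrite -us.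
case: (covS _ _ uv) => [uS|vS]; first exact: (adj_case s u).
have vs : v != s by apply: contraNneq vN => ->.
rewrite (cardsD1 s) sS ltnS (cardsD1 v) !inE vs vS /=.
have dom x : x \in S -> x \in closed_nbh (u |: S :\ s :\ v).
  move=> xS; apply/closed_nbhP.
  case: (eqVneq x s) => [->|xs].
    by exists u; rewrite ?setU11 //; right; rewrite adj_sym.
  case: (eqVneq x v) => [->|xv]; first by exists u; rewrite ?setU11 //; right.
  by exists x; rewrite ?inE ?xs ?xv ?xS ?orbT //; left.
apply: (@isolation_number_le (u |: S :\ s :\ v)).
  by move=> x y /covS[] /dom; [left|right].
by rewrite cardsU1; apply: leq_add => //; case: (_ \notin _).
Qed.

(** * Replacing edges of [F] by endpoints *)

Lemma edge_endpoint F (f : {set G}) (x : G) : F \subset edges G -> f \in F -> x \in f ->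
  exists2 y, adj x y & f = [set x; y].
Proof.
move=> FE fF; have /edgesP[u [v [uv ->]]] := subsetP FE _ fF.
case/set2P=> ->; first by exists v.
by exists u; [rewrite adj_sym|rewrite setUC].
Qed.

(** [R] takes one endpoint of each edge, which dominates the other; [z] is preferred wherever it is
    available. The default in [odflt] is never reached on [F], since edges are nonempty. *)
Lemma cover_representatives F (z : G) : F \subset edges G ->
  exists R, [/\ #|R| <= #|F|, z \in cover F -> z \in R
             & {subset cover F <= closed_nbh R}].
Proof.
move=> FE.
pose r (e : {set G}) := if z \in e then z else odflt z [pick x in e].
have re e : e \in F -> r e \in e.
  move=> eF; rewrite /r; case: ifP => // _; case: pickP => // e0.
  have /edgesP[x [y [_ exy]]] := subsetP FE _ eF.
  by have := e0 x; rewrite exy !inE eqxx.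
exists (r @: F); split=> [|/bigcupP[e eF ze]|x /bigcupP[e eF xe]].
- exact: leq_imset_card.
- by apply/imsetP; exists e; rewrite // /r ze.
have [y ry exy] := edge_endpoint FE eF (re e eF).
apply/closed_nbhP; exists (r e); first exact: imset_f.
by move: xe; rewrite {1}exy => /set2P[->|->]; [left|right].
Qed.

Lemma subset_closed_nbh S D x :
  S \subset D -> x \in closed_nbh S -> x \in closed_nbh D.
Proof.
move=> /subsetP SD /closed_nbhP[y yS yx].
by apply/closed_nbhP; exists y => //; apply: SD.
Qed.

Lemma in_closed_nbh S x : x \in S -> x \in closed_nbh S.
Proof. by move=> xS; apply/closed_nbhP; exists x => //; left. Qed.

Lemma adj_closed_nbh S x y : x \in S -> adj x y -> y \in closed_nbh S.
Proof. by move=> xS xy; apply/closed_nbhP; exists x => //; right. Qed.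

Lemma coverD1 F (f : {set G}) (x : G) : x \in cover F -> x \notin f -> x \in cover (F :\ f).
Proof.
case/bigcupP=> g gF xg xf; apply/bigcupP; exists g => //.
by rewrite !inE gF andbT; apply: contraNneq xf => <-.
Qed.

(** The vertex [a] allows for an unsubdivided edge at a vertex covered by [F]. If [F] is the single
    edge [f] at [a], then [a |: S] is a vertex cover; otherwise an edge [f0] other than [f] is
    dropped, and [f] keeps [a] dominated. *)
Lemma isolation_lt_cover_edges S F (a : G) :
  connected G -> ~ is_star G -> F \subset edges G -> a \in cover F ->
  (forall x y, adj x y -> [\/ x \in a |: S, y \in a |: S
                            | x \in cover F /\ y \in cover F]) ->
  isolation_number G < #|S| + #|F|.
Proof.
move=> connG nstar FE /bigcupP[f fF af] covSF.
have [b ab fab] := edge_endpoint FE fF af.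
case: (set_0Vmem (F :\ f)) => [F1|[f0]].
  have -> : F = [set f] by rewrite -(setD1K fF) F1 setU0.
  rewrite cards1 addn1; apply: (@leq_trans #|a |: S|); last first.
    by rewrite cardsU1 -addn1 addnC leq_add2l; case: (_ \notin _).
  apply: isolation_lt_cover => // x y xy.
  case: (covSF _ _ xy) => [||[]]; [by left|by right|].
  have -> : cover F = f by rewrite -(setD1K fF) F1 setU0 /cover big_set1.
  rewrite fab => /set2P[->|xE]; first by left; rewrite setU11.
  case/set2P=> yE; first by right; rewrite yE setU11.
  by move: xy; rewrite xE yE adj_irr.
rewrite !inE => /andP[f0f f0F].
have aC' : a \in cover (F :\ f0).
  by apply/bigcupP; exists f; rewrite // !inE eq_sym f0f.
have cardf e : e \in F -> #|e| = 2.
  move=> /(subsetP FE)/edgesP[x [y [xy ->]]]; rewrite cards2.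
  by case: eqVneq xy => // ->; rewrite adj_irr.
(* Distinct two-element sets are not nested, so some vertex lies outside [f0] and an edge [pz]
   leaves [f0]. *)
have [w wf wf0] : exists2 w, w \in f & w \notin f0.
  apply/subsetPn; apply: contra f0f => ff0.
  by rewrite eq_sym eqEcard ff0 !cardf.
have [u uf0] : exists u, u \in f0 by apply/card_gt0P; rewrite cardf.
have [p [z [pf0 zf0 pz]]] := exit_edge connG uf0 wf0.
have [|R [cardR zR covR]] := @cover_representatives (F :\ f0) z.
  by apply: subset_trans FE; apply: subsetDl.
have domC' x : x \in cover (F :\ f0) -> x \in closed_nbh (S :|: R).
  by move/covR; apply/subset_closed_nbh/subsetUr.
have domS x : x \in a |: S -> x \in closed_nbh (S :|: R).
  case/setU1P=> [->|xS]; first exact: domC'.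
  by apply: in_closed_nbh; rewrite inE xS.
(* Apply the covering hypothesis to [pz]: either [p] lies in [a |: S], or [z] lies in [S] or is
   covered by [F :\ f0]. In the last case [z] was preferred as a representative, so it is in [R] and
   dominates [p]. *)
have domp : p \in closed_nbh (S :|: R).
  have zC'p : z \in cover (F :\ f0) -> p \in closed_nbh (S :|: R).
    move/zR => {}zR; apply: (@adj_closed_nbh _ z); first by rewrite inE zR orbT.
    by rewrite adj_sym.
  case: (covSF _ _ pz) => [/domS //|/setU1P[zE|zS]|[_ zC]].
  - by apply: zC'p; rewrite zE.
  - apply: (@adj_closed_nbh _ z); first by rewrite inE zS.
    by rewrite adj_sym.
  - by apply: zC'p; apply: coverD1.
rewrite (cardsD1 f0) f0F addnCA add1n ltnS.
apply: (@isolation_number_le (S :|: R)); last first.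
  by rewrite (leq_trans (leq_card_setU _ _)) // leq_add2l.
move=> x y xy; case: (covSF _ _ xy) => [/domS|/domS|[xC yC]]; [by left|by right|].
case: (boolP (x \in f0)) => xf0; last by left; apply/domC'/coverD1.
case: (boolP (y \in f0)) => yf0; last by right; apply/domC'/coverD1.
(* The only edge still in doubt is [f0] itself, and its endpoint [p] is dominated. *)
have /eqP f0xy : [set x; y] == f0.
  rewrite eqEcard subUset !sub1set xf0 yf0 cardf // cards2.
  by case: eqVneq xy => // ->; rewrite adj_irr.
by move: pf0; rewrite -f0xy => /set2P[] <-; [left|right].
Qed.

(** Exchanging [a] for [b] keeps the size, and [b] dominates [a], itself and [z]. An edge [f0] of
    [F] at [z] can then be dropped: the only edge inside [f0] is [f0], which has the dominated
    endpoint [z]. *)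
Lemma isolation_lt_exchange S F (a b z : G) :
  F \subset edges G -> a \in S -> adj a b -> adj b z -> z \in cover F ->
  (forall x y, adj x y -> [\/ x \in S, y \in S
                            | x \in b |: cover F /\ y \in b |: cover F]) ->
  isolation_number G < #|S| + #|F|.
Proof.
move=> FE aS ab bz /bigcupP[f0 f0F zf0] covSF.
have [|R [cardR _ covR]] := @cover_representatives (F :\ f0) b.
  by apply: subset_trans FE; apply: subsetDl.
set T := (b |: S :\ a) :|: R.
have bT : b \in T by rewrite !inE eqxx.
have domC' x : x \in b |: cover F -> x \notin f0 -> x \in closed_nbh T.
  case/setU1P=> [-> _|xC xf0]; first exact: in_closed_nbh.
  by have /covR := coverD1 xC xf0; apply/subset_closed_nbh/subsetUr.
have domS x : x \in S -> x \in closed_nbh T.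
  case: (eqVneq x a) => [-> _|xa xS].
    by apply: (adj_closed_nbh bT); rewrite adj_sym.
  by apply: in_closed_nbh; rewrite !inE xa xS orbT.
rewrite (cardsD1 f0) f0F (cardsD1 a) aS add1n addSn ltnS addnA.
apply: (@isolation_number_le T); last first.
  rewrite (leq_trans (leq_card_setU _ _)) // leq_add //.
  by rewrite cardsU1 addnC leq_add2l; case: (_ \notin _).
move=> x y xy; case: (covSF _ _ xy) => [/domS|/domS|[xC yC]]; [by left|by right|].
case: (boolP (x \in f0)) => xf0; last by left; apply: domC'.
case: (boolP (y \in f0)) => yf0; last by right; apply: domC'.
have zT : z \in closed_nbh T by apply: adj_closed_nbh bT bz.
have /edgesP[u [v [_ f0E]]] := subsetP FE _ f0F.
move: xf0 yf0 zf0 xy zT; rewrite f0E.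
by do 3![case/set2P=> ->]; rewrite ?adj_irr //; [left|right|right|left] => //.
Qed.

(** With [F] empty, [S] is a vertex cover; otherwise any vertex covered by [F] can serve as [a] in
    [isolation_lt_cover_edges]. *)
Lemma isolation_lt_cover_or_edges S F :
  connected G -> ~ is_star G -> F \subset edges G ->
  (forall x y, adj x y -> [\/ x \in S, y \in S
                            | x \in cover F /\ y \in cover F]) ->
  isolation_number G < #|S| + #|F|.
Proof.
move=> connG nstar FE covSF; case: (set_0Vmem F) => [F0|[f fF]].
  rewrite F0 cards0 addn0; apply: isolation_lt_cover => // x y /covSF[xS|yS|[]]; [by left|by right|].
  by rewrite F0 /cover big_set0 inE.
have /edgesP[a [b [_ fab]]] := subsetP FE _ fF.
apply: (@isolation_lt_cover_edges _ _ a) => //.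
  by apply/bigcupP; exists f; rewrite // fab set21.
move=> x y /covSF[xS|yS|]; last by constructor 3.
  by constructor 1; rewrite inE xS orbT.
by constructor 2; rewrite inE yS orbT.
Qed.

End Isolation.

(** * The trace on [G] of a vertex set of the subdivision *)

Section SubdivisionTrace.
Variables (G : sgraph) (A : {set {set G}}) (D : {set subdivide A}).

Definition trace_vertices : {set G} := [set x | inl x \in D].

Definition trace_edges : {set {set G}} :=
  [set val e | e : {e : {set G} | e \in A} & inr e \in D].

Lemma card_trace : #|trace_vertices| + #|trace_edges| <= #|D|.
Proof.
rewrite -[leqRHS]sum1_card big_sumType /= !sum1dep_card leq_add //.
exact: leq_trans (leq_imset_card _ _) _.
Qed.

Lemma trace_edges_sub : trace_edges \subset A.
Proof. by apply/subsetP => _ /imsetP[e _ ->]; apply: valP. Qed.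

Lemma trace_nbh_vertex x : inl x \in closed_nbh D ->
  [\/ x \in trace_vertices, x \in cover trace_edges
    | exists2 a, a \in trace_vertices & adj a x /\ [set a; x] \notin A].
Proof.
case/closed_nbhP=> -[a|e] yD [yx|].
- by constructor 1; rewrite inE yx.
- by case/andP=> ax axA; constructor 3; exists a; rewrite ?inE.
- by [].
by move=> /= xe; constructor 2; apply/bigcupP; exists (val e); rewrite // imset_f ?inE.
Qed.

Lemma trace_nbh_edge (e : {e : {set G} | e \in A}) : inr e \in closed_nbh D ->
  val e \in trace_edges \/ exists2 x, x \in trace_vertices & x \in val e.
Proof.
case/closed_nbhP=> -[a|f] yD [yx|] //=.
- by right; exists a; rewrite ?inE.
by left; case: yx => ->; rewrite imset_f ?inE.
Qed.

Hypothesis isoD : isolating D.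

(** If the subdivision vertex of [xy] is dominated, then it or one of [x], [y] is in [D]. If not,
    its two incident edges force both [x] and [y] to be dominated. *)
Lemma trace_subdivided x y : adj x y -> [set x; y] \in A ->
  [\/ x \in trace_vertices, y \in trace_vertices,
     x \in cover trace_edges /\ y \in cover trace_edges
   | inl x \in closed_nbh D /\ inl y \in closed_nbh D].
Proof.
move=> xy xyA; pose e : {e : {set G} | e \in A} :=
  exist (fun e => e \in A) _ xyA.
have [eN|eN] := boolP ((inr e : subdivide A) \in closed_nbh D).
  case: (trace_nbh_edge eN) => [eF|[z zS /set2P[] zE]].
  - by constructor 3; split; apply/bigcupP; exists (val e); rewrite //= !inE eqxx ?orbT.
  - by constructor 1; rewrite -zE.
  - by constructor 2; rewrite -zE.
move/isolatingP: isoD => dom; constructor 4.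
split.
  by case: (dom (inl x) (inr e) (set21 x y)); rewrite // (negbTE eN).
by case: (dom (inl y) (inr e) (set22 x y)); rewrite // (negbTE eN).
Qed.

Lemma trace_unsubdivided x y : adj x y -> [set x; y] \notin A ->
  inl x \in closed_nbh D \/ inl y \in closed_nbh D.
Proof.
move=> xy xyA; move/isolatingP: isoD => dom.
by apply: (dom (inl x) (inl y)); rewrite /= xy xyA.
Qed.

End SubdivisionTrace.

(** * The bound for subdividing all edges but at most one *)

Unset Implicit Arguments.

Theorem theorem3p6 (G : sgraph) (connG : connected G) (nstarG : ~ is_star G)
    (A : {set {set G}}) (sAE : A \subset edges G)
    (cardA : #|edges G| - 1 <= #|A|) :
  isolation_number G + 1 <= isolation_number (subdivide A).
Proof.
rewrite addn1; have [[D isoD <-] _] := isolation_numberP (subdivide A).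
apply: leq_trans (card_trace D).
set S := trace_vertices D; set F := trace_edges D.
have FE : F \subset edges G by apply: subset_trans sAE; apply: trace_edges_sub.
have uniqB (x y u v : G) : adj x y -> [set x; y] \notin A ->
    adj u v -> [set u; v] \notin A -> [set x; y] = [set u; v].
  move=> xy xyA uv uvA.
  have /card_le1_eqP B1 : #|edges G :\: A| <= 1.
    by rewrite cardsD (setIidPr sAE) leq_subLR addnC -leq_subLR.
  by apply: B1; rewrite inE ?xyA ?uvA edges_adj.
(* An endpoint dominated through an unsubdivided edge is dominated through [xy] itself, by
   [uniqB]. *)
have touch x y : adj x y -> [set x; y] \notin A ->
    [\/ x \in S, y \in S, x \in cover F | y \in cover F].
  move=> xy xyA.
  have nbh z : z \in [set x; y] -> inl z \in closed_nbh D ->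
      [\/ x \in S, y \in S, x \in cover F | y \in cover F].
    move=> zxy /trace_nbh_vertex[zS|zF|[a aS [az azA]]].
    - by case/set2P: zxy => <-; [constructor 1|constructor 2].
    - by case/set2P: zxy => <-; [constructor 3|constructor 4].
    have: a \in [set x; y] by rewrite (uniqB _ _ _ _ xy xyA az azA) set21.
    by case/set2P=> <-; [constructor 1|constructor 2].
  by case: (trace_unsubdivided isoD xy xyA) => /nbh; apply; rewrite !inE eqxx ?orbT.
(* Domination along the unsubdivided edge is the only way for an original vertex [b] to be dominated
   while outside both [S] and [cover F]. *)
pose exchangeable a b :=
  [&& a \in S, b \notin S, b \notin cover F, adj a b & [set a; b] \notin A].
case: (boolP [exists a, exists b, exchangeable a b]).
  case/existsP=> a /existsP[b /and5P[aS bS bF ab abA]].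
  have nbh x : inl x \in closed_nbh D -> x \in S \/ x \in b |: cover F.
    case/trace_nbh_vertex=> [xS|xF|[c cS [cx cxA]]]; first by left.
      by right; rewrite inE xF orbT.
    have: x \in [set a; b] by rewrite (uniqB _ _ _ _ ab abA cx cxA) set22.
    by case/set2P=> ->; [left|right; rewrite setU11].
  have covSF x y : adj x y -> [\/ x \in S, y \in S
      | x \in b |: cover F /\ y \in b |: cover F].
    move=> xy; case: (boolP ([set x; y] \in A)) => xyA.
      case: (trace_subdivided isoD xy xyA) => [xS|yS|[xF yF]|[/nbh xN /nbh yN]].
      - by constructor 1.
      - by constructor 2.
      - by constructor 3; rewrite !inE xF yF !orbT.
      case: xN => xN; first by constructor 1.
      by case: yN => yN; [constructor 2|constructor 3].
    have: a \in [set x; y] by rewrite (uniqB _ _ _ _ xy xyA ab abA) set21.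
    by case/set2P=> <-; [constructor 1|constructor 2].
  case: (boolP [exists z in cover F, adj b z]) => [/exists_inP[z zF bz]|nbz].
    exact: (@isolation_lt_exchange _ S F a b z).
  have nadj z : adj b z -> z \in b |: cover F -> False.
    move=> bz /setU1P[zb|zF]; first by move: bz; rewrite zb adj_irr.
    by case/negP: nbz; apply/exists_inP; exists z.
  apply: isolation_lt_cover_or_edges => // x y xy.
  case: (covSF _ _ xy) => [xS|yS|[xN yN]]; [by constructor 1|by constructor 2|].
  constructor 3; case/setU1P: (xN) => [xb|xF].
    by move: xy; rewrite xb => /nadj/(_ yN).
  case/setU1P: (yN) => [yb|//].
  by move: xy; rewrite yb adj_sym => /nadj/(_ xN).
move=> nexch.
have nbh x : inl x \in closed_nbh D -> x \in S \/ x \in cover F.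
  case/trace_nbh_vertex=> [xS|xF|[a aS [ax axA]]]; [by left|by right|].
  apply/orP; apply: contraNT nexch; rewrite negb_or => /andP[xS xF].
  by apply/existsP; exists a; apply/existsP; exists x; apply/and5P.
have covA x y : adj x y -> [set x; y] \in A ->
    [\/ x \in S, y \in S | x \in cover F /\ y \in cover F].
  move=> xy xyA.
  case: (trace_subdivided isoD xy xyA) => [xS|yS|xyF|[/nbh xN /nbh yN]].
  - by constructor 1.
  - by constructor 2.
  - by constructor 3.
  case: xN => xN; first by constructor 1.
  by case: yN => yN; [constructor 2|constructor 3].
(* An unsubdivided edge with an endpoint [a] covered by [F] meets [a |: S]. *)
case: (boolP [exists a in cover F, [exists b, adj a b && ([set a; b] \notin A)]]).
  case/exists_inP=> a aF /existsP[b /andP[ab abA]].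
  apply: (@isolation_lt_cover_edges _ S F a) => // x y xy.
  case: (boolP ([set x; y] \in A)) => xyA.
    case: (covA _ _ xy xyA) => [xS|yS|xyF]; last by constructor 3.
      by constructor 1; rewrite inE xS orbT.
    by constructor 2; rewrite inE yS orbT.
  have: a \in [set x; y] by rewrite (uniqB _ _ _ _ xy xyA ab abA) set21.
  by case/set2P=> <-; [constructor 1|constructor 2]; rewrite setU11.
(* Now no unsubdivided edge has an endpoint covered by [F], so by [touch] each one meets [S]. *)
move=> nF; apply: isolation_lt_cover_or_edges => // x y xy.
case: (boolP ([set x; y] \in A)) => xyA; first exact: covA.
case: (touch _ _ xy xyA) => [xS|yS|xF|yF]; [by constructor 1|by constructor 2| |].
  case/negP: nF; apply/exists_inP; exists x => //.
  by apply/existsP; exists y; rewrite xy.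
case/negP: nF; apply/exists_inP; exists y => //.
by apply/existsP; exists x; rewrite adj_sym xy setUC.
Qed.
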